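(* Let $\gamma>1$ and let $f,g:D\to\mathbb{R}$ be continuous with $[\delta f\cup\delta g]_\gamma<\infty$. Then $f\cup\delta g$ is $\gamma$-sewable and, writing $f\,\mathsf{d}g:=\operatorname{sew}(f\cup\delta g)$, one has $$[f\cup\delta g-f\,\mathsf{d}g]_\gamma\le c\,[\delta f\cup\delta g]_\gamma,$$ where $c=c(\gamma)$ is a constant depending only on $\gamma$.
   Context: Let $D\subseteq\mathbb{R}^d$ be a set. A $k$-simplex in $D$ is a tuple $S=[p_0p_1\ldots p_k]\in D^{k+1}$ with $\operatorname{conv}(S)\subseteq D$; $\operatorname{Simp}^k(D)$ is the set of $k$-simplices. A $k$-germ in $D$ is a function $\omega:\operatorname{Simp}^k(D)\to\mathbb{R}$, written $\omega_S=\langle S,\omega\rangle$ and extended linearly to chains (finite real linear combinations of simplices); $0$-germs are functions on $D$. The boundary is $\partial[p_0\ldots p_k]=\sum_{i=0}^k(-1)^i[p_0\ldots\hat p_i\ldots p_k]$, and $\langle S,\delta\omega\rangle:=\langle\partial S,\omega\rangle$; in particular $(\delta f)_{pq}=f_q-f_p$. The cup product of a $k$-germ $\omega$ and an $h$-germ $\tilde\omega$ is $(\omega\cup\tilde\omega)_{p_0\ldots p_{k+h}}=\omega_{p_0\ldots p_k}\tilde\omega_{p_k\ldots p_{k+h}}$; so $(f\cup\delta g)_{pq}=f_p(g_q-g_p)$ and $(\delta f\cup\delta g)_{pqr}=(f_q-f_p)(g_r-g_q)$. For a simplex $S$, $\operatorname{diam}(S)$ is the maximal distance between its vertices. For a germ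 $\omega$, $[\omega]_\gamma\in[0,\infty]$ is the infimum of constants $c\ge0$ with $|\omega_S|\le c\operatorname{diam}(S)^\gamma$ for all simplices $S$ (of the relevant dimension) in $D$. A $1$-germ $\omega$ is nonatomic if $\omega_{pp}=0$ for all $p\in D$, and closed on lines if $(\delta\omega)_{pqr}=0$ for every $[pqr]\in\operatorname{Simp}^2(D)$ with $p,q,r$ collinear; it is regular if it is both. For $\gamma>1$, a $1$-germ $\omega$ is $\gamma$-sewable if there exists a (necessarily unique) regular $1$-germ $\operatorname{sew}\omega$ with $[\omega-\operatorname{sew}\omega]_\gamma<\infty$. *)

(* Defs.v *)
From HB Require Import structures.
From mathcomp Require Import all_boot all_order all_algebra.
From mathcomp Require Import all_classical all_reals all_analysis.

Set Implicit Arguments.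
Unset Strict Implicit.
Unset Printing Implicit Defensive.

Import Order.TTheory GRing.Theory Num.Theory.
Import numFieldNormedType.Exports.

Local Open Scope classical_set_scope.
Local Open Scope ring_scope.

Section Germs.
Context {R : realType} {d : nat}.

(* The norm `|x| that MathComp-Analysis puts on 'rV[R]_d is the sup norm;
   distances between points are taken in the Euclidean norm. The two norms
   induce the same topology, so continuity is the library's. *)
Definition eucl_norm (x : 'rV[R]_d) : R := Num.sqrt (\sum_(i < d) x 0 i ^+ 2).

Definition conv_hull (A : set 'rV[R]_d) : set 'rV[R]_d :=
  smallest (@convex_set R 'rV[R]_d) A.

(* A k-simplex [p_0 ... p_k] is the (k+1)-tuple of its vertices; it may be
   degenerate. *)
Definition Simp (k : nat) (D : set 'rV[R]_d) : set (k.+1.-tuple 'rV[R]_d) :=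
  [set S | [set` S] `<=` D /\ conv_hull [set` S] `<=` D].

Definition diam k (S : k.+1.-tuple 'rV[R]_d) : R :=
  \big[Num.max/0]_(i < k.+1) \big[Num.max/0]_(j < k.+1)
     eucl_norm (tnth S i - tnth S j).

(* A k-germ in D is encoded by a total function, of which only the values on
   Simp k D matter: every notion below that depends on D looks at these values
   only. Likewise a function on D is a total function on R^d. *)
Definition germ (k : nat) : Type := k.+1.-tuple 'rV[R]_d -> R.

Definition germ0 (f : 'rV[R]_d -> R) : germ 0 := fun S => f (thead S).

(* a chain is a formal sum, listed as its (coefficient, simplex) terms *)
Definition chain (k : nat) : Type := seq (R * k.+1.-tuple 'rV[R]_d).

Definition pairing k (c : chain k) (w : germ k) : R :=
  \sum_(a <- c) a.1 * w a.2.

Definition face k (i : 'I_k.+2) (S : k.+2.-tuple 'rV[R]_d) :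
  k.+1.-tuple 'rV[R]_d := [tuple tnth S (lift i j) | j < k.+1].

Definition boundary k (S : k.+2.-tuple 'rV[R]_d) : chain k :=
  [seq ((-1) ^+ (i : nat), face i S) | i : 'I_k.+2 <- enum 'I_k.+2].

Definition coboundary k (w : germ k) : germ k.+1 :=
  fun S => pairing (boundary S) w.

Definition cup k h (w : germ k) (w' : germ h) : germ (k + h) :=
  fun S => w [tuple tnth S (inord i) | i < k.+1] *
           w' [tuple tnth S (inord (k + i)) | i < h.+1].

(* [w]_gamma; the infimum of the empty set is +oo *)
Definition seminorm k (D : set 'rV[R]_d) (gamma : R) (w : germ k) : \bar R :=
  ereal_inf [set c%:E | c in [set c : R | 0 <= c /\
    forall S, Simp D S -> `|w S| <= c * (diam S) `^ gamma]].

Definition nonatomic (D : set 'rV[R]_d) (w : germ 1) : Prop :=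
  forall p, D p -> w [tuple p; p] = 0.

Definition collinear k (S : k.+1.-tuple 'rV[R]_d) : Prop :=
  exists a v : 'rV[R]_d, forall i, exists t : R, tnth S i = a + t *: v.

Definition closed_on_lines (D : set 'rV[R]_d) (w : germ 1) : Prop :=
  forall S, Simp D S -> collinear S -> coboundary w S = 0.

Definition regular_germ (D : set 'rV[R]_d) (w : germ 1) : Prop :=
  nonatomic D w /\ closed_on_lines D w.

Definition is_sew (D : set 'rV[R]_d) (gamma : R) (w : germ 1) : set (germ 1) :=
  [set s | regular_germ D s /\
           (seminorm D gamma (w \- s)%R < +oo)%E].

Definition sewable (D : set 'rV[R]_d) (gamma : R) (w : germ 1) : Prop :=
  is_sew D gamma w !=set0.

(* For 1 < gamma the values of sew on Simp 1 D do not depend on the choice. *)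
Definition sew (D : set 'rV[R]_d) (gamma : R) (w : germ 1) : germ 1 :=
  xget (fun=> 0) (is_sew D gamma w).

Lemma coboundaryE k (w : germ k) S :
  coboundary w S = \sum_(i < k.+2) (-1) ^+ (i : nat) * w (face i S).
Proof. by rewrite /coboundary /pairing /boundary big_map big_enum. Qed.

Lemma coboundary_germ0E (f : 'rV[R]_d -> R) p q :
  coboundary (germ0 f) [tuple p; q] = f q - f p.
Proof.
rewrite coboundaryE !big_ord_recl big_ord0 /germ0 /face /thead !tnth_mktuple.
by rewrite !(tnth_nth 0) /= expr0 mul1r expr1 mulN1r addr0.
Qed.

Lemma cup_germ0_coboundaryE (f g : 'rV[R]_d -> R) p q :
  cup (germ0 f) (coboundary (germ0 g)) [tuple p; q] = f p * (g q - g p).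
Proof.
rewrite /cup -coboundary_germ0E; congr (_ * _).
  by rewrite /germ0 /thead tnth_mktuple (tnth_nth 0) inordK.
apply: congr1; apply: eq_from_tnth => i.
by rewrite tnth_mktuple !(tnth_nth 0) inordK; case: i => [[|[|]]].
Qed.

Lemma cup_coboundaryE (f g : 'rV[R]_d -> R) p q r :
  cup (coboundary (germ0 f)) (coboundary (germ0 g)) [tuple p; q; r] =
  (f q - f p) * (g r - g q).
Proof.
rewrite /cup -!coboundary_germ0E; congr (_ * _);
  apply: congr1; apply: eq_from_tnth => i;
  by rewrite tnth_mktuple !(tnth_nth 0) inordK; case: i => [[|[|]]].
Qed.

End Germs.

(* Main.v *)
Require Import Defs.
From mathcomp Require Import all_boot all_order all_algebra.
From mathcomp Require Import all_classical all_reals all_analysis.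
From mathcomp Require Import lra.

Import Order.TTheory GRing.Theory Num.Theory.
Import numFieldNormedType.Exports.

Local Open Scope classical_set_scope.
Local Open Scope ring_scope.

(** The defect of the germ [w = f \cup \delta g] on a triple [pqr] is exactly
    [(\delta f \cup \delta g)_{pqr}], so on every segment of [D] the germ [w] is
    additive up to an error of order [gamma > 1] in the length. The theorem is
    then a sewing lemma: a nonatomic germ whose coboundary is
    [O(diam ^ gamma)] lies within [O(diam ^ gamma)] of a unique regular germ.

    The candidate on [[pq]] is the limit of the Riemann sums of [w] over the
    dyadic subdivisions of the segment. Passing from level [n] to level [n + 1]
    changes the sum by [2 ^ n] defects of size [2 ^ (- n gamma)], so the sums
    converge geometrically, and the total change gives the estimate with
    constant [1 / (1 - 2 ^ (1 - gamma))] ([sewing_bound],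
    [dyadic_sew_bound]).

    What is not obvious is additivity: for [q] inside [[pr]], the dyadic
    subdivisions of [[pq]], [[qr]] and [[pr]] are unrelated. On a fixed segment,
    parametrized by [[0, 1]], the dyadic grid of the whole segment is
    therefore used for all its subintervals [[x, y]], by composing [w] with the
    clamping map onto [[x, y]]. For these sums additivity fails only in the one
    cell containing the common endpoint, hence holds in the limit
    ([clamped_sum_add]), which produces a potential [phi] with
    [phi y - phi x] close to [w x y] ([ex_potential]). The price is that the
    estimate between [phi] and [w] comes only with the exponent
    [(1 + gamma) / 2]; but this is still larger than [1], and any exponent
    larger than [1] forces the dyadic sums of [w] over each subinterval, in
    either direction, to converge to the increment of [phi]
    ([dyadic_sum_cvg_potential]). So the dyadic limits are increments of
    [phi], and the candidate is closed on lines.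

    The last lemma also gives uniqueness: restricted to a segment, a regular
    germ close to [w] is the increment of a potential, hence equals the dyadic
    limit. This transfers the sharp estimate to the germ chosen in [sew]. *)

(** * Dyadic sums of germs on the unit interval *)

Section DyadicSums.
Context {R : realType}.
Implicit Types (w : R -> R -> R) (a b x y z s t : R).

Lemma cvg_geometric_steps (u : R^nat) (A r : R) : 0 < r < 1 ->
  (forall n, `|u n.+1 - u n| <= A * r ^+ n) ->
  cvgn u /\ `|limn u - u 0%N| <= A / (1 - r).
Proof.
move=> /andP[r0 r1] hu.
have A0 : 0 <= A by have := hu 0%N; rewrite expr0 mulr1; apply: le_trans.
have r1' : `|r| < 1 by rewrite gtr0_norm.
have cs : cvgn (series (telescope u)).
  apply: normed_cvg; apply: (@series_le_cvg _ _ (geometric A r)) => //=.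
  - by move=> n; rewrite mulr_ge0// exprn_ge0// ltW.
  - exact: is_cvg_geometric_series.
have uE : u = (fun n => u 0%N + series (telescope u) n).
  by apply/funext => n; exact: eq_sum_telescope.
have cu : cvgn u by rewrite uE; apply: is_cvgD => //; exact: is_cvg_cst.
split=> //.
have -> : `|limn u - u 0%N| = limn (fun n => `|u n - u 0%N|).
  apply/esym/cvg_lim => //; apply: cvg_norm; apply: cvgB => //.
  exact: cvg_cst.
apply: limr_le.
  by apply: is_cvg_norm; apply: is_cvgB => //; exact: is_cvg_cst.
apply: nearW => n.
rewrite {1}uE addrAC subrr add0r.
apply: (le_trans _ (geometric_le_lim n A0 r0 r1')).
rewrite /series/=; apply: (le_trans (ler_norm_sum _ _ _)).
by apply: ler_sum => k _; exact: hu.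
Qed.

Lemma powRXn x a n : 0 <= x -> (x ^+ n) `^ a = (x `^ a) ^+ n.
Proof.
by move=> x0; rewrite -!powR_mulrn ?powR_ge0// -!powRrM mulrC.
Qed.

Lemma powR_half_lt1 a : 0 < a -> 0 < (2^-1 : R) `^ a < 1.
Proof.
move=> a0; rewrite powR_gt0 ?invr_gt0//=.
have := @gt0_ltr_powR R a a0 2^-1 1; rewrite powR1; apply; rewrite ?nnegrE; lra.
Qed.

(** The gain for [1 < g]: a quantity of order [g] in the length of a cell sums,
    over the [2 ^ n] cells of level [n], to a geometrically small amount. *)
Lemma sum_cells (K g : R) n :
  \sum_(k < 2 ^ n) K * (2^-1 ^+ n) `^ g = K * (2^-1 `^ (g - 1)) ^+ n :> R.
Proof.
rewrite sumr_const card_ord -[LHS]mulr_natl natrX powRXn ?invr_ge0//.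
have -> : (2^-1 : R) `^ g = 2^-1 * 2^-1 `^ (g - 1).
  rewrite -[X in X * _]powRr1 ?invr_ge0// -powRD; last first.
    by apply/implyP => _; rewrite invr_eq0.
  by congr (_ `^ _); lra.
rewrite exprMn exprVn mulrCA (mulrA (2 ^+ n)) mulfV ?mul1r// expf_neq0.
Qed.

Definition node n k : R := k%:R * 2^-1 ^+ n.

Definition dyadic_sum w n := \sum_(k < 2 ^ n) w (node n k) (node n k.+1).

Definition defect w x y z := w x y + w y z - w x z.

Lemma nodeS n k : node n k.+1 - node n k = 2^-1 ^+ n.
Proof. by rewrite /node -mulrBl -natrB// subSnn mul1r. Qed.

Lemma node_double n k : node n.+1 k.*2 = node n k.
Proof.
by rewrite /node -muln2 natrM exprS mulrA -(mulrA _ 2) mulfV ?mulr1 ?pnatr_eq0.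
Qed.

Lemma node_le n k l : (k <= l)%N -> node n k <= node n l.
Proof. by move=> kl; rewrite ler_wpM2r ?exprn_ge0 ?invr_ge0// ler_nat. Qed.

Lemma node0 n : node n 0 = 0. Proof. by rewrite /node mul0r. Qed.

Lemma node_last n : node n (2 ^ n) = 1.
Proof. by rewrite /node natrX exprVn mulfV// expf_neq0. Qed.

Lemma node01 n k : (k <= 2 ^ n)%N -> 0 <= node n k <= 1.
Proof.
move=> kn; apply/andP; split; first by rewrite -(node0 n) node_le.
by rewrite -[leRHS](node_last n) node_le.
Qed.

Lemma dyadic_sum0 w : dyadic_sum w 0 = w 0 1.
Proof.
by rewrite /dyadic_sum big_ord_recl big_ord0 addr0 node0 (node_last 0).
Qed.

Lemma sum_pairs (F : nat -> R) n :
  \sum_(k < n.*2) F k = \sum_(k < n) (F k.*2 + F k.*2.+1).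
Proof.
elim: n => [|n IH]; first by rewrite !big_ord0.
by rewrite doubleS !big_ord_recr/= IH addrA.
Qed.

Lemma dyadic_sumS w n : dyadic_sum w n.+1 - dyadic_sum w n =
  \sum_(k < 2 ^ n) defect w (node n k) (node n.+1 k.*2.+1) (node n k.+1).
Proof.
rewrite /dyadic_sum expnS mul2n.
rewrite (sum_pairs (fun k => w (node n.+1 k) (node n.+1 k.+1))) -sumrB.
by apply: eq_bigr => k _; rewrite node_double -doubleS node_double.
Qed.

Lemma sum_node_steps (phi : R -> R) n :
  \sum_(k < 2 ^ n) (phi (node n k.+1) - phi (node n k)) = phi 1 - phi 0.
Proof.
rewrite -(big_mkord predT (fun k => phi (node n k.+1) - phi (node n k))).
by rewrite (telescope_sumr (fun k => phi (node n k)))// node_last node0.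
Qed.

(** Each refinement adds the defects at the midpoints of the cells, and level
    [0] is [w 0 1] itself; the constant is the sum of the geometric series of
    ratio [2 * 2^-1 `^ g = 2^-1 `^ (g - 1)]. *)
Lemma sewing_bound w (C g : R) : 1 < g ->
  (forall x y z, 0 <= x <= 1 -> 0 <= y <= 1 -> 0 <= z <= 1 -> x <= y <= z ->
     `|defect w x y z| <= C * (z - x) `^ g) ->
  `|limn (dyadic_sum w) - w 0 1| <= C / (1 - 2^-1 `^ (g - 1)).
Proof.
move=> g1 hw; rewrite -dyadic_sum0.
apply: (cvg_geometric_steps (dyadic_sum w) C _ _ _).2.
  by apply: powR_half_lt1; lra.
move=> n; rewrite dyadic_sumS -sum_cells.
apply: (le_trans (ler_norm_sum _ _ _)); apply: ler_sum => k _.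
rewrite -(nodeS n k); apply: hw; try (apply: node01);
  rewrite ?(ltnW (ltn_ord k))//.
  by rewrite expnS mul2n ltn_double.
by rewrite -(node_double n k) -(node_double n k.+1) !node_le//= doubleS.
Qed.

(** The increments of [phi] telescope over the cells, so the sums of [w] differ
    from [phi 1 - phi 0] by [2 ^ n] errors of order [g] in [2 ^- n]. *)
Lemma dyadic_sum_cvg_potential w (phi : R -> R) (K g : R) : 1 < g ->
  (forall x y, 0 <= x <= 1 -> 0 <= y <= 1 -> x <= y ->
     `|phi y - phi x - w x y| <= K * (y - x) `^ g) ->
  limn (dyadic_sum w) = phi 1 - phi 0.
Proof.
move=> g1 hphi; apply: cvg_lim => //; apply/subr_cvg0.
apply: norm_cvg0; apply: (@squeeze_cvgr _ _ _ _ (fun=> 0)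
  (geometric K (2^-1 `^ (g - 1)))); last 2 first.
- exact: cvg_cst.
- apply: cvg_geometric; rewrite ger0_norm ?powR_ge0//.
  by have /andP[] : 0 < (2^-1 : R) `^ (g - 1) < 1 by apply: powR_half_lt1; lra.
apply: nearW => n; rewrite normr_ge0/= distrC -(sum_node_steps phi n).
rewrite /dyadic_sum -sumrB -(sum_cells K g n).
apply: (le_trans (ler_norm_sum _ _ _)); apply: ler_sum => k _.
rewrite -(nodeS n k); apply: hphi; last exact: node_le.
- by apply: node01; exact: ltnW.
- exact: node01.
Qed.

(** * A potential for a germ of small defect *)

Definition clamp x y t := Num.max x (Num.min y t).

Lemma clamp_id x y t : x <= t <= y -> clamp x y t = t.
Proof. by move=> /andP[xt ty]; rewrite /clamp min_r// max_r. Qed.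

Lemma clamp_le x y t : x <= y -> t <= x -> clamp x y t = x.
Proof.
by move=> xy tx; rewrite /clamp min_r ?max_l//; exact: (le_trans tx).
Qed.

Lemma clamp_ge x y t : x <= y -> y <= t -> clamp x y t = y.
Proof. by move=> xy yt; rewrite /clamp min_l// max_r. Qed.

Lemma clamp_bounds x y t : x <= y -> x <= clamp x y t <= y.
Proof.
move=> xy; have [tx|xt] := leP t x; first by rewrite clamp_le// lexx.
have [yt|ty] := leP y t; first by rewrite clamp_ge// lexx xy.
by rewrite clamp_id; lra.
Qed.

Lemma clamp_lip x y s t : x <= y -> s <= t ->
  0 <= clamp x y t - clamp x y s <= t - s.
Proof.
move=> xy st; have := clamp_bounds x y t xy; have := clamp_bounds x y s xy.
have [sx|xs] := leP s x; have [yt|ty] := leP y t.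
- by rewrite clamp_le// clamp_ge//; lra.
- rewrite (clamp_le x y s)//; have [tx|xt] := leP t x.
    by rewrite clamp_le//; lra.
  by rewrite clamp_id//; lra.
- rewrite (clamp_ge x y t)//; have [ys|sy] := leP y s.
    by rewrite clamp_ge//; lra.
  by rewrite clamp_id//; lra.
- by rewrite !clamp_id//; lra.
Qed.

(** The dyadic sums of [clamped w x y] are the Riemann sums of [w] over the
    subdivision of [[x, y]] by its endpoints and the points of the grid of
    [[0, 1]]: the cells outside [[x, y]] collapse to [w x x] or [w y y]. *)
Definition clamped w x y s t := w (clamp x y s) (clamp x y t).

(** The points come in any order, with [l] bounding their diameter: the case
    [z = x] controls [w x y + w y x], that is, the reversal of a segment. *)
Definition controlled w (C g : R) := forall x y z l,
  0 <= x <= 1 -> 0 <= y <= 1 -> 0 <= z <= 1 ->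
  `|y - x| <= l -> `|z - y| <= l -> `|z - x| <= l ->
  `|defect w x y z| <= C * l `^ g.

Section Potential.
Context {w : R -> R -> R} {C g : R}.
Context (g1 : 1 < g) (C0 : 0 <= C).
Context (w0 : forall x, 0 <= x <= 1 -> w x x = 0) (hw : controlled w C g).

Let a : R := (g - 1) / 2.

Let a0 : 0 < a. Proof. by rewrite divr_gt0 ?subr_gt0. Qed.

(** The clamped cells have lengths [l] that add up to [y - x], each at most
    [y - x] and at most [2 ^- n]. Splitting [l `^ g = l * l `^ a * l `^ a] and
    using one bound on each power gives decay in [n] and still an exponent
    larger than [1] in [y - x], without counting the cells that meet
    [[x, y]]. *)
Lemma sum_clamp_cells x y n : 0 <= x -> x <= y -> y <= 1 ->
  \sum_(k < 2 ^ n) C * (clamp x y (node n k.+1) - clamp x y (node n k)) `^ g <=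
  C * (y - x) `^ (1 + a) * (2^-1 `^ a) ^+ n.
Proof.
move=> x0 xy y1.
have e1 : (y - x) `^ (1 + a) = (y - x) * (y - x) `^ a.
  rewrite powRD ?powRr1 ?subr_ge0//; apply/implyP => /eqP.
  by move: a0 => /[swap] <-; rewrite gtrDr ltr10.
have e2 : y - x = \sum_(k < 2 ^ n)
    (clamp x y (node n k.+1) - clamp x y (node n k)).
  by rewrite sum_node_steps clamp_ge// clamp_le.
rewrite e1 {1}e2 -mulrA -mulrA mulr_suml mulr_sumr; apply: ler_sum => k _.
apply: ler_wpM2l => //.
have kk : node n k <= node n k.+1 by exact: node_le.
have := clamp_lip x y _ _ xy kk; rewrite nodeS.
have := clamp_bounds x y (node n k) xy.
have := clamp_bounds x y (node n k.+1) xy.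
move: (clamp x y _) (clamp x y _) => v u hu hv /andP[l0 l1].
have [->|uv] := eqVneq u v.
  by rewrite subrr mul0r powR0// gt_eqF// (lt_trans ltr01).
have -> : (u - v) `^ g = (u - v) * ((u - v) `^ a * (u - v) `^ a).
  rewrite -{2}(powRr1 l0) -!powRD ?subr_eq0 ?uv ?implybT//.
  by congr (_ `^ _); rewrite /a; lra.
apply: ler_wpM2l => //; apply: ler_pM; rewrite ?powR_ge0//.
  by apply: ge0_ler_powR; rewrite ?nnegrE ?(ltW a0)//; lra.
rewrite -powRXn ?invr_ge0//; apply: ge0_ler_powR; rewrite ?nnegrE ?(ltW a0)//.
Qed.

Let r01 : 0 < (2^-1 : R) `^ a < 1. Proof. exact: powR_half_lt1. Qed.

Lemma clamped_sum_cvg x y : 0 <= x -> x <= y -> y <= 1 ->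
  cvgn (dyadic_sum (clamped w x y)) /\
  `|limn (dyadic_sum (clamped w x y)) - w x y| <=
    C * (y - x) `^ (1 + a) / (1 - 2^-1 `^ a).
Proof.
move=> x0 xy y1.
have -> : w x y = dyadic_sum (clamped w x y) 0.
  by rewrite dyadic_sum0 /clamped clamp_le// clamp_ge.
apply: cvg_geometric_steps => // n.
apply: (le_trans _ (sum_clamp_cells x y n x0 xy y1)).
rewrite dyadic_sumS; apply: (le_trans (ler_norm_sum _ _ _)).
apply: ler_sum => k _; rewrite /defect /clamped.
have h1 : node n k <= node n.+1 k.*2.+1.
  by rewrite -(node_double n k) node_le.
have h2 : node n.+1 k.*2.+1 <= node n k.+1.
  by rewrite -(node_double n k.+1) node_le// doubleS.
have := clamp_lip x y _ _ xy h1; have := clamp_lip x y _ _ xy h2.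
have := clamp_bounds x y (node n k) xy.
have := clamp_bounds x y (node n k.+1) xy.
have := clamp_bounds x y (node n.+1 k.*2.+1) xy.
by move=> *; apply: hw; rewrite ?ger0_norm; lra.
Qed.

(** Cell by cell: a cell on one side of [y] contributes equally to both sides,
    and the cell around [y] contributes one defect; the sum of all of these is
    bounded by [sum_clamp_cells]. *)
Lemma clamped_sum_add x y z : 0 <= x -> x <= y -> y <= z -> z <= 1 ->
  limn (dyadic_sum (clamped w x y)) + limn (dyadic_sum (clamped w y z)) =
  limn (dyadic_sum (clamped w x z)).
Proof.
move=> x0 xy yz z1; have xz := le_trans xy yz.
have [cxy _] := clamped_sum_cvg x y x0 xy (le_trans yz z1).
have [cyz _] := clamped_sum_cvg y z (le_trans x0 xy) yz z1.
have [cxz _] := clamped_sum_cvg x z x0 xz z1.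
apply/eqP; rewrite -subr_eq0; apply/eqP.
rewrite -limD// -limB//; last exact: is_cvgD.
apply: cvg_lim => //; apply: norm_cvg0.
apply: (@squeeze_cvgr _ _ _ _ (fun=> 0)
  (geometric (C * (z - x) `^ (1 + a)) (2^-1 `^ a))); last 2 first.
- exact: cvg_cst.
- by apply: cvg_geometric; case/andP: r01 => *; rewrite ger0_norm// ltW.
apply: nearW => n; rewrite normr_ge0/=.
apply: (le_trans _ (sum_clamp_cells x z n x0 xz z1)).
rewrite /dyadic_sum !fctE -big_split -sumrB/=.
apply: (le_trans (ler_norm_sum _ _ _)).
apply: ler_sum => k _; rewrite /clamped.
have kk : node n k <= node n k.+1 by exact: node_le.
have ge0 : 0 <= C * (clamp x z (node n k.+1) - clamp x z (node n k)) `^ g.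
  by rewrite mulr_ge0// powR_ge0.
move: (node n k) (node n k.+1) kk ge0 => s t st ge0.
(* the cell lies to the left of y *)
have [ty|yt] := leP t y.
  have e u : u <= y -> clamp x z u = clamp x y u.
    by move=> uy; rewrite /clamp !min_r//; lra.
  rewrite !(clamp_le y z)//; last lra.
  rewrite w0; last lra.
  by rewrite !e ?addr0 ?subrr ?normr0//; move: ge0; rewrite !e//; lra.
(* the cell lies to the right of y *)
have [ys|sy] := leP y s.
  have e u : y <= u -> clamp x z u = clamp y z u.
    by move=> uy; rewrite /clamp !max_r// le_min; lra.
  rewrite !(clamp_ge x y)//; last lra.
  rewrite w0; last lra.
  by rewrite !e ?add0r ?subrr ?normr0//; move: ge0; rewrite !e//; lra.
(* y is interior to the cell *)
have sy' := ltW sy; have yt' := ltW yt.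
rewrite (clamp_ge x y t)// (clamp_le y z s)//.
have -> : clamp x y s = clamp x z s by rewrite /clamp !min_r//; lra.
have -> : clamp y z t = clamp x z t.
  by rewrite /clamp !max_r// le_min; lra.
have := clamp_lip x z _ _ xz sy'; have := clamp_lip x z _ _ xz yt'.
rewrite (clamp_id x z y); last lra.
have := clamp_bounds x z s xz; have := clamp_bounds x z t xz.
by move=> *; apply: hw; rewrite ?ger0_norm; lra.
Qed.

(** Additivity turns the limits of the clamped sums into increments of
    [phi t], the limit over [[0, t]]. For [y < x] the estimate on [[y, x]] is
    transferred by the defect of [x, y, x]. *)
Lemma ex_potential : exists phi K, forall x y,
  0 <= x <= 1 -> 0 <= y <= 1 ->
  `|phi y - phi x - w x y| <= K * `|y - x| `^ ((1 + g) / 2).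
Proof.
pose phi t := limn (dyadic_sum (clamped w 0 t)).
pose K := C / (1 - 2^-1 `^ a).
have -> : (1 + g) / 2 = 1 + a by rewrite /a; lra.
have up x y : 0 <= x -> x <= y -> y <= 1 ->
    `|phi y - phi x - w x y| <= K * (y - x) `^ (1 + a).
  move=> x0 xy y1; have [_] := clamped_sum_cvg x y x0 xy y1.
  rewrite /phi -(clamped_sum_add 0 x y)//.
  rewrite [X in _ -> `|X - _ - _| <= _]addrC addrK.
  by rewrite /K mulrAC.
exists phi, (K + C) => x y /andP[x0 x1] /andP[y0 y1].
have [xy|yx] := leP x y.
  apply: (le_trans (up x y x0 xy y1)).
  by rewrite ger0_norm ?subr_ge0// ler_wpM2r ?powR_ge0// lerDl.
have yx' := ltW yx.
have -> : phi y - phi x - w x y =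
    - (phi x - phi y - w y x) - defect w x y x.
  by rewrite /defect w0 ?x0//; lra.
apply: (le_trans (ler_normB _ _)); rewrite normrN mulrDl.
rewrite (distrC y x) [X in _ <= _ * X `^ _ + _ * X `^ _]ger0_norm ?subr_ge0//.
apply: lerD; first exact: up.
apply: (@le_trans _ _ (C * (x - y) `^ g)).
  have e : `|x - y| = x - y by rewrite ger0_norm ?subr_ge0.
  by apply: hw; rewrite ?subrr ?normr0 ?(distrC y x) ?e ?x0 ?y0// subr_ge0.
apply: ler_wpM2l => //; apply: ger_powR; first lra.
by have : 1 < g := g1; rewrite /a; lra.
Qed.

End Potential.

End DyadicSums.

(** * Segments and simplices *)

Section Geometry.
Context {R : realType} {d : nat}.
Implicit Types (p q u v : 'rV[R]_d) (s t x y : R) (D : set 'rV[R]_d).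

Definition line p q t := p + t *: (q - p).

Lemma line0 p q : line p q 0 = p. Proof. by rewrite /line scale0r addr0. Qed.

Lemma line1 p q : line p q 1 = q.
Proof. by rewrite /line scale1r addrC subrK. Qed.

Lemma line_refl p t : line p p t = p.
Proof. by rewrite /line subrr scaler0 addr0. Qed.

Lemma lineB p q s t : line p q t - line p q s = (t - s) *: (q - p).
Proof. by rewrite /line opprD addrACA subrr add0r scalerBl. Qed.

Lemma line_line p q s t x :
  line (line p q s) (line p q t) x = line p q (s + x * (t - s)).
Proof. by rewrite {1}/line lineB scalerA /line -addrA -scalerDl. Qed.

Lemma between01 s t x : 0 <= s <= 1 -> 0 <= t <= 1 -> 0 <= x <= 1 ->
  0 <= s + x * (t - s) <= 1.
Proof. by move=> *; nra. Qed.

Lemma conv_hull_line (A : set 'rV[R]_d) p q t : 0 <= t <= 1 ->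
  conv_hull A p -> conv_hull A q -> conv_hull A (line p q t).
Proof.
move=> /andP[t0 t1] Ap Aq B [cB AB].
have Bp : p \in B by rewrite inE; apply: Ap.
have Bq : q \in B by rewrite inE; apply: Aq.
have := cB q p (Itv01 t0 t1) Bq Bp; rewrite inE; congr B.
rewrite /conv/= /line /unstable.onem scalerBl scale1r scalerBr.
by rewrite addrCA.
Qed.

Lemma Simp_conv_hull D k l (S : k.+1.-tuple 'rV[R]_d)
    (T : l.+1.-tuple 'rV[R]_d) :
  Simp D S -> (forall i, conv_hull [set` S] (tnth T i)) -> Simp D T.
Proof.
move=> [_ SD] TS.
have TS' : [set` T] `<=` conv_hull [set` S].
  by move=> p /= /tnthP[i ->].
split; first exact: subset_trans SD.
apply: subset_trans SD; apply: smallest_sub TS'.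
move=> p q t; rewrite !inE => pS qS B [cB SB].
by have := cB p q t; rewrite !inE; apply; [apply: pS|apply: qS].
Qed.

Lemma conv_hull_tnth k (S : k.+1.-tuple 'rV[R]_d) i :
  conv_hull [set` S] (tnth S i).
Proof. by apply: sub_gen_smallest; rewrite /= mem_tnth. Qed.

Lemma eucl_normZ t p : eucl_norm (t *: p) = `|t| * eucl_norm p.
Proof.
rewrite /eucl_norm -sqrtr_sqr -sqrtrM ?sqr_ge0// mulr_sumr.
by congr Num.sqrt; apply: eq_bigr => i _; rewrite mxE exprMn.
Qed.

Lemma diam_le k (S : k.+1.-tuple 'rV[R]_d) x : 0 <= x ->
  (forall i j, eucl_norm (tnth S i - tnth S j) <= x) -> diam S <= x.
Proof. by move=> x0 h; do 2 !apply: bigmax_le => // ? _. Qed.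

Lemma le_diam k (S : k.+1.-tuple 'rV[R]_d) i j :
  eucl_norm (tnth S i - tnth S j) <= diam S.
Proof.
rewrite /diam; apply: le_trans (le_bigmax _ _ i) => /=.
exact: (le_bigmax 0 (fun j => eucl_norm (tnth S i - tnth S j)) j).
Qed.

Lemma diam_ge0 k (S : k.+1.-tuple 'rV[R]_d) : 0 <= diam S.
Proof. by apply: le_trans (le_diam _ S ord0 ord0); exact: sqrtr_ge0. Qed.

Lemma diam_line k (S : k.+1.-tuple 'rV[R]_d) (tau : k.+1.-tuple R) p q x :
  (forall i, tnth S i = line p q (tnth tau i)) ->
  (forall i j, `|tnth tau i - tnth tau j| <= x) ->
  diam S <= x * eucl_norm (q - p).
Proof.
move=> hS htau; have N0 : 0 <= eucl_norm (q - p) by exact: sqrtr_ge0.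
apply: diam_le => [|i j].
  by rewrite mulr_ge0//; exact: le_trans (htau ord0 ord0).
by rewrite !hS lineB eucl_normZ ler_wpM2r.
Qed.

(** All vertices lie on the segment between the two extreme ones, which, unlike
    the rest of the line, is contained in the convex hull. *)
Lemma collinear_line k (S : k.+1.-tuple 'rV[R]_d) : collinear S ->
  exists i j, forall l, exists2 t, 0 <= t <= 1 &
    tnth S l = line (tnth S i) (tnth S j) t.
Proof.
move=> [a [v /choice[tau h]]].
pose i := [arg min_(i < ord0) tau i]%O; pose j := [arg max_(i > ord0) tau i]%O.
have mi l : tau i <= tau l by rewrite /i; case: arg_minP => // m _; apply.
have mj l : tau l <= tau j by rewrite /j; case: arg_maxP => // m _; apply.
exists i, j => l; have := mi l; have := mj l; rewrite !h.
move: (tau i) (tau j) (tau l) => s t x xt sx.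
have [st|ts] := ltP s t; last first.
  exists 0; first by rewrite lexx ler01.
  by rewrite line0 (_ : x = s)//; apply/eqP; rewrite eq_le sx (le_trans xt ts).
exists ((x - s) / (t - s)).
  rewrite divr_ge0 ?subr_ge0 ?(ltW st)//= ler_pdivrMr ?subr_gt0// mul1r.
  by rewrite lerB.
have lineE y : a + y *: v = line a (a + v) y by rewrite /line (addrC a v) addrK.
rewrite !lineE line_line; congr line.
by rewrite divfK ?subr_eq0 ?gt_eqF// addrC subrK.
Qed.

Lemma tuple2_eta (T : Type) (S : 2.-tuple T) :
  S = [tuple tnth S 0; tnth S 1].
Proof.
by case: S => -[|a [|b []]]// i; apply: val_inj; rewrite /= !(tnth_nth a).
Qed.

Lemma tuple3_eta (T : Type) (S : 3.-tuple T) :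
  S = [tuple tnth S 0; tnth S 1; tnth S 2].
Proof.
by case: S => -[|a [|b [|c []]]]// i; apply: val_inj; rewrite /= !(tnth_nth a).
Qed.

Lemma coboundary1E (w : @germ R d 1) p q u :
  coboundary w [tuple p; q; u] =
  w [tuple q; u] - w [tuple p; u] + w [tuple p; q].
Proof.
rewrite coboundaryE !big_ord_recl big_ord0 /= expr0 expr1 sqrrN expr1n.
rewrite !mul1r mulN1r addr0 addrA.
by congr (w _ - w _ + w _); rewrite [LHS]tuple2_eta /face !tnth_mktuple.
Qed.

End Geometry.

(** * The sewing lemma *)

Section Sewing.
Context {R : realType} {d : nat} (D : set 'rV[R]_d).
Implicit Types (p q : 'rV[R]_d) (s t x y C g : R) (w : @germ R d 1).

Definition germ_on_line w p q x y := w [tuple line p q x; line p q y].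

Definition dyadic_sew w : germ 1 :=
  fun S => limn (dyadic_sum (germ_on_line w (tnth S 0) (tnth S 1))).

Lemma defect_germ_on_line w p q x y z : defect (germ_on_line w p q) x y z =
  coboundary w [tuple line p q x; line p q y; line p q z].
Proof. by rewrite coboundary1E /defect /germ_on_line; lra. Qed.

Lemma germ_on_line_controlled w C g k (S : k.+1.-tuple 'rV[R]_d) p q : 0 < g ->
  0 <= C ->
  Simp D S -> conv_hull [set` S] p -> conv_hull [set` S] q ->
  (forall T, Simp D T -> `|coboundary w T| <= C * diam T `^ g) ->
  controlled (germ_on_line w p q) (C * eucl_norm (q - p) `^ g) g.
Proof.
move=> g0 C0 SD Sp Sq hw x y z l x01 y01 z01 xy yz xz.
have l0 : 0 <= l by apply: le_trans xy.
rewrite defect_germ_on_line.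
set T := [tuple _; _; _].
have TD : Simp D T.
  apply: (Simp_conv_hull _ _ _ _ _ SD) => i; rewrite (tnth_nth 0).
  by case: i => -[|[|[]]]//= _; exact: conv_hull_line.
apply: (le_trans (hw _ TD)).
rewrite -mulrA; apply: ler_wpM2l => //.
have N0 : 0 <= eucl_norm (q - p) by exact: sqrtr_ge0.
rewrite -powRM//; apply: ge0_ler_powR;
  rewrite ?nnegrE ?diam_ge0 ?mulr_ge0 ?(ltW g0)//.
rewrite [leRHS]mulrC; apply: (diam_line _ _ [tuple x; y; z]) => [i|i j];
  rewrite !(tnth_nth 0).
  by case: i => -[|[|[]]].
case: i => -[|[|[]]]//= _; case: j => -[|[|[]]]//= _;
  by rewrite ?subrr ?normr0// distrC.
Qed.

(** The exponent of [ex_potential] is weaker than [g] but exceeds [1], which is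
    all that [dyadic_sum_cvg_potential] needs on each subsegment, traversed in
    either direction. *)
Lemma dyadic_sew_potential w C g k (S : k.+1.-tuple 'rV[R]_d) p q : 1 < g ->
  0 <= C -> nonatomic D w ->
  (forall T, Simp D T -> `|coboundary w T| <= C * diam T `^ g) ->
  Simp D S -> conv_hull [set` S] p -> conv_hull [set` S] q ->
  exists phi : R -> R, forall s t, 0 <= s <= 1 -> 0 <= t <= 1 ->
    dyadic_sew w [tuple line p q s; line p q t] = phi t - phi s.
Proof.
move=> g1 C0 wna hw SD Sp Sq.
have g0 := lt_trans ltr01 g1.
have hc := germ_on_line_controlled _ _ _ _ _ _ _ g0 C0 SD Sp Sq hw.
have w0 x : 0 <= x <= 1 -> germ_on_line w p q x x = 0.
  by move=> x01; apply: wna; apply: SD.2; exact: conv_hull_line.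
have C0' : 0 <= C * eucl_norm (q - p) `^ g by rewrite mulr_ge0 ?powR_ge0.
have [phi [K hphi]] := ex_potential g1 C0' w0 hc.
exists phi => s t s01 t01; rewrite /dyadic_sew !(tnth_nth 0)/=.
have e x := between01 s t x s01 t01.
have b1 : 1 < (1 + g) / 2 by lra.
rewrite (dyadic_sum_cvg_potential _ (fun x => phi (s + x * (t - s)))
  (K * `|t - s| `^ ((1 + g) / 2)) _ b1); last first.
  move=> x y x01 y01 xy; rewrite /germ_on_line !line_line.
  apply: (le_trans (hphi _ _ (e _ x01) (e _ y01))).
  rewrite opprD addrACA subrr add0r -mulrBl normrM.
  rewrite (@ger0_norm _ (y - x)) ?subr_ge0//.
  by rewrite powRM// ?subr_ge0// -mulrA (mulrC (_ `^ _)).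
by rewrite mul1r mul0r addr0 (addrC s) subrK.
Qed.

(** For a collinear triple, the three values are increments of one potential
    on the segment between the extreme vertices. *)
Lemma dyadic_sew_regular w C g : 1 < g -> 0 <= C -> nonatomic D w ->
  (forall T, Simp D T -> `|coboundary w T| <= C * diam T `^ g) ->
  regular_germ D (dyadic_sew w).
Proof.
move=> g1 C0 wna hw; split=> [p Dp|S SD /collinear_line[i [j h]]].
  rewrite /dyadic_sew !(tnth_nth 0)/=; apply: cvg_lim => //.
  rewrite (_ : dyadic_sum _ = fun=> 0); first exact: cvg_cst.
  apply/funext => n; rewrite /dyadic_sum big1// => k _.
  by rewrite /germ_on_line !line_refl; exact: wna.
have Sc := conv_hull_tnth _ S.
have [phi hphi] :=
  dyadic_sew_potential _ _ _ _ _ _ _ g1 C0 wna hw SD (Sc i) (Sc j).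
rewrite (tuple3_eta _ S) coboundary1E.
have [x x01 ->] := h 0; have [y y01 ->] := h 1; have [z z01 ->] := h 2.
rewrite !hphi//; lra.
Qed.

Lemma dyadic_sew_bound w C g p q : 1 < g -> 0 <= C ->
  (forall T, Simp D T -> `|coboundary w T| <= C * diam T `^ g) ->
  Simp D [tuple p; q] ->
  `|w [tuple p; q] - dyadic_sew w [tuple p; q]| <=
    (1 - 2^-1 `^ (g - 1))^-1 * C * diam [tuple p; q] `^ g.
Proof.
move=> g1 C0 hw SD; set S := [tuple p; q].
have Sc := conv_hull_tnth _ S.
have g0 := lt_trans ltr01 g1.
have hc :=
  germ_on_line_controlled _ _ _ _ _ _ _ g0 C0 SD (Sc 0) (Sc 1) hw.
have -> : w S = germ_on_line w (tnth S 0) (tnth S 1) 0 1.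
  by rewrite /germ_on_line line0 line1 -tuple2_eta.
have /andP[r0 r1] : 0 < (2^-1 : R) `^ (g - 1) < 1.
  by apply: powR_half_lt1; lra.
rewrite distrC; apply: (le_trans (sewing_bound _ _ _ g1 _)).
  move=> x y z x01 y01 z01 /andP[xy yz]; apply: hc => //;
    rewrite ger0_norm; lra.
rewrite mulrC -mulrA ler_pM2l ?invr_gt0 ?subr_gt0// ler_wpM2l//.
have N0 : 0 <= eucl_norm (tnth S 1 - tnth S 0) by exact: sqrtr_ge0.
have NS := le_diam _ S 1 0.
apply: ge0_ler_powR => //; rewrite ?nnegrE//; last exact: le_trans NS.
exact: ltW (lt_trans ltr01 g1).
Qed.

(** On [[pq]] the regular germ [v] has the potential
    [phi t = v_{p, p + t (q - p)}], so the sums of [w] converge to its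
    increment. *)
Lemma dyadic_sew_unique w v K g p q : 1 < g -> 0 <= K -> regular_germ D v ->
  (forall T, Simp D T -> `|w T - v T| <= K * diam T `^ g) ->
  Simp D [tuple p; q] -> v [tuple p; q] = dyadic_sew w [tuple p; q].
Proof.
move=> g1 K0 [vna vcl] hwv SD; set S := [tuple p; q].
have Sp := conv_hull_tnth _ S 0; have Sq := conv_hull_tnth _ S 1.
have Dp : D p by apply: SD.2; move: Sp; rewrite (tnth_nth 0).
have onS k (T : k.+1.-tuple 'rV[R]_d) :
    (forall i, exists2 t, 0 <= t <= 1 & tnth T i = line p q t) -> Simp D T.
  move=> hT; apply: (Simp_conv_hull _ _ _ _ _ SD) => i.
  have [t t01 ->] := hT i.
  exact: conv_hull_line.
have pE : p = line p q 0 by rewrite line0.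
pose phi t := v [tuple p; line p q t].
have vE s t : 0 <= s <= 1 -> 0 <= t <= 1 ->
    v [tuple line p q s; line p q t] = phi t - phi s.
  move=> s01 t01.
  pose T := [tuple p; line p q s; line p q t].
  have TE i : exists2 t, 0 <= t <= 1 & tnth T i = line p q t.
    rewrite (tnth_nth 0); case: i => -[|[|[]]]//= _; last 2 first.
    - by exists s.
    - by exists t.
    by exists 0 => //; rewrite lexx ler01.
  have cT : collinear T.
    by exists p, (q - p) => i; have [x _ ->] := TE i; exists x.
  have := vcl T (onS _ _ TE) cT.
  by rewrite coboundary1E -/(phi s) -/(phi t); lra.
rewrite /dyadic_sew !(tnth_nth 0)/=.
rewrite (dyadic_sum_cvg_potential _ phi (K * eucl_norm (q - p) `^ g) _ g1).
  by rewrite /phi line0 line1 (vna p)// subr0.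
move=> x y x01 y01 xy; rewrite -vE// distrC.
set T := [tuple _; _].
have TE i : exists2 t, 0 <= t <= 1 & tnth T i = line p q t.
  by rewrite (tnth_nth 0); case: i => -[|[|[]]]//= _; [exists x|exists y].
apply: (le_trans (hwv _ (onS _ _ TE))).
have N0 : 0 <= eucl_norm (q - p) by exact: sqrtr_ge0.
have g0 : 0 <= g by exact: ltW (lt_trans ltr01 g1).
rewrite -mulrA ler_wpM2l// -powRM ?subr_ge0//.
apply: ge0_ler_powR => //; rewrite ?nnegrE ?diam_ge0// ?mulr_ge0 ?subr_ge0//.
rewrite [leRHS]mulrC; apply: (diam_line _ _ [tuple x; y]) => [i|i j].
  by rewrite !(tnth_nth 0); case: i => -[|[]].
have yx : `|y - x| = y - x by rewrite ger0_norm ?subr_ge0.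
by rewrite !(tnth_nth 0); case: i => -[|[]]//= _; case: j => -[|[]]//= _;
  rewrite ?subrr ?normr0 ?(distrC x) ?yx ?subr_ge0.
Qed.

End Sewing.

(** * Seminorms, and the germ of a Stieltjes integral *)

Section Seminorm.
Context {R : realType} {d : nat} (D : set 'rV[R]_d).

Lemma seminorm_le k (w : @germ R d k) (g c : R) : 0 <= c ->
  (forall S, Simp D S -> `|w S| <= c * diam S `^ g) ->
  (seminorm D g w <= c%:E)%E.
Proof. by move=> c0 hc; apply: ereal_inf_lbound; exists c. Qed.

(** The infimum is attained because each of the inequalities that define the
    admissible constants is closed. *)
Lemma seminorm_attained k (w : @germ R d k) (g : R) :
  (seminorm D g w < +oo)%E ->
  exists2 m, seminorm D g w = m%:E &
    0 <= m /\ forall S, Simp D S -> `|w S| <= m * diam S `^ g.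
Proof.
move=> fin.
have n0 : (0 <= seminorm D g w)%E.
  by apply: le_ereal_inf_tmp => _ [c [c0 _] <-]; rewrite lee_fin.
have fn : seminorm D g w \is a fin_num.
  by rewrite ge0_fin_numE.
exists (fine (seminorm D g w)); first by rewrite fineK.
split=> [|S SD]; first exact: fine_ge0.
have [_ [c [c0 hc] <-] _] := ereal_inf_lt fin.
have [dS|dS] := eqVneq (diam S `^ g) 0.
  by have := hc S SD; rewrite dS !mulr0.
have dS0 : 0 < diam S `^ g by rewrite lt_neqAle eq_sym dS powR_ge0.
rewrite -ler_pdivrMr// -lee_fin fineK//.
apply: le_ereal_inf_tmp => _ [e [e0 he] <-].
by rewrite lee_fin ler_pdivrMr// he.
Qed.

Lemma coboundary_cup (f g : 'rV[R]_d -> R) (S : 3.-tuple 'rV[R]_d) :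
  coboundary (cup (germ0 f) (coboundary (germ0 g)) : germ 1) S =
  cup (coboundary (germ0 f)) (coboundary (germ0 g)) S.
Proof.
rewrite (tuple3_eta _ S) cup_coboundaryE coboundary1E.
by rewrite !cup_germ0_coboundaryE; lra.
Qed.

End Seminorm.

Theorem theorem4p1 (R : realType) (gamma : R) (hgamma : 1 < gamma) :
  exists c : R, forall (d : nat) (D : set 'rV[R]_d) (f g : 'rV[R]_d -> R),
    {within D, continuous f} -> {within D, continuous g} ->
    (seminorm D gamma
       (cup (coboundary (germ0 f)) (coboundary (germ0 g))) < +oo)%E ->
    let fdeltag : germ 1 := cup (germ0 f) (coboundary (germ0 g)) in
    let fdg : germ 1 := sew D gamma fdeltag in
    sewable D gamma fdeltag /\
    (seminorm D gamma (fdeltag \- fdg)%R <=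
      c%:E * seminorm D gamma
               (cup (coboundary (germ0 f)) (coboundary (germ0 g))))%E.
Proof.
exists (1 - 2^-1 `^ (gamma - 1))^-1.
move=> d D f g _ _ fin fdeltag fdg.
have [m -> [m0 hm]] := seminorm_attained _ _ _ _ fin.
have c0 : 0 <= (1 - (2^-1 : R) `^ (gamma - 1))^-1.
  have /andP[_ r1] : 0 < (2^-1 : R) `^ (gamma - 1) < 1.
    by apply: powR_half_lt1; rewrite subr_gt0.
  by rewrite invr_ge0 subr_ge0 ltW.
have na : nonatomic D fdeltag.
  by move=> p _; rewrite /fdeltag cup_germ0_coboundaryE subrr mulr0.
have hd S : Simp D S -> `|coboundary fdeltag S| <= m * diam S `^ gamma.
  by move=> SD; rewrite coboundary_cup; exact: hm.
have near S : Simp D S -> `|(fdeltag \- dyadic_sew fdeltag) S| <=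
    (1 - 2^-1 `^ (gamma - 1))^-1 * m * diam S `^ gamma.
  rewrite (tuple2_eta _ S); exact: (dyadic_sew_bound _ _ _ _ _ _ hgamma m0 hd).
have swb : sewable D gamma fdeltag.
  exists (dyadic_sew fdeltag); split.
    exact: (dyadic_sew_regular _ _ _ _ hgamma m0 na hd).
  apply: le_lt_trans (ltry ((1 - 2^-1 `^ (gamma - 1))^-1 * m)).
  by apply: seminorm_le near; exact: mulr_ge0.
split=> //.
have [reg fin'] : is_sew D gamma fdeltag fdg by exact: xgetPex swb.
have [K _ [K0 hK]] := seminorm_attained _ _ _ _ fin'.
rewrite -EFinM; apply: seminorm_le => [|S SD]; first exact: mulr_ge0.
have := near S SD; rewrite (tuple2_eta _ S) in SD *.
by rewrite /= (dyadic_sew_unique _ fdeltag fdg K gamma _ _ hgamma K0 reg hK SD).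
Qed.
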